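(* Let $G=(V,E)$ be a graph and let $\nu$ be a balanced measure on $G$. Then $\nu$ is basic if and only if $(\operatorname{spt}\nu,M_\nu)$ is a maximal element of $\{(\operatorname{spt}\rho,M_\rho):\rho\text{ is a balanced measure on }G\}$ with respect to the partial order $\le$ on $\mathcal{P}(V)\times\mathcal{P}(V)$ given by: $(S,M)\le(S',M')$ if and only if $S\supseteq S'$ and $M\subseteq M'$.
   Context: Every graph is finite, connected and simple with unit edge weights; $d(u,v)$ is the graph distance; $\mathcal{P}(V)$ is the power set of $V$. A probability measure on $V$ is identified with a function $\mu:V\to\mathbb{R}_{\ge 0}$ with $\sum_{v\in V}\mu(v)=1$. The support is $\operatorname{spt}\mu=\{v\in V:\mu(v)>0\}$. The transport cost function is $T_\mu(v)=\sum_{u\in V}d(u,v)\mu(u)$, and the cost-maximizing set is $M_\mu=\{v\in V: T_\mu(v)=\max_{u\in V}T_\mu(u)\}$. A probability measure $\mu$ is balanced if $\operatorname{spt}\mu\subseteq M_\mu$. A probability measure $\mu$ is basic if for every probability measure $\nu\ne\mu$ on $V$ at least one of $\operatorname{spt}\mu\neq\operatorname{spt}\nu$ or $M_\mu\ne M_\nu$ holds. *)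

(* Defs.v *)
From HB Require Import structures.
From mathcomp Require Import all_boot all_order all_algebra.
From mathcomp Require Import reals.

Set Implicit Arguments.
Unset Strict Implicit.
Unset Printing Implicit Defensive.

Import Order.TTheory GRing.Theory Num.Theory.

Local Open Scope ring_scope.

Record connected_graph := ConnectedGraph {
  vertex :> finType;
  edge : rel vertex;
  edge_sym : symmetric edge;
  edge_irrefl : irreflexive edge;
  edge_connected : forall u v : vertex, connect edge u v
}.

Section Distance.
Variable G : connected_graph.
Implicit Types u v : G.

Definition has_walk (u v : G) (n : nat) : bool :=
  [exists p : n.-tuple G, path (@edge G) u p && (last u p == v)].

Lemma has_walk_exists u v : exists n, has_walk u v n.
Proof.
have /connectP[p p_path ->] := edge_connected u v.
by exists (size p); apply/existsP; exists (in_tuple p); rewrite p_path eqxx.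
Qed.

Definition gdist (u v : G) : nat := ex_minn (has_walk_exists u v).

End Distance.

(* The conditions are boolean, so equality of measures is equality of the
   underlying functions, by val_inj. *)
Record pmeasure (R : realType) (V : finType) := PMeasure {
  pmass :> {ffun V -> R};
  _ : [forall v, 0 <= pmass v] && (\sum_v pmass v == 1)
}.

HB.instance Definition _ (R : realType) (V : finType) :=
  [isSub for @pmass R V].
HB.instance Definition _ (R : realType) (V : finType) :=
  [Equality of pmeasure R V by <:].

Section Transport.
Variables (R : realType) (G : connected_graph).
Implicit Types mu nu rho : pmeasure R G.

Definition spt mu : {set G} := [set v | 0 < mu v].

Definition cost mu (v : G) : R := \sum_u (gdist u v)%:R * mu u.

(* The initial value cost mu v is itself one of the terms, so the iterated
   maximum is the maximum of cost mu over all the vertices. *)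
Definition cost_max mu : {set G} :=
  [set v | cost mu v == \big[Num.max/cost mu v]_u cost mu u].

Definition balanced mu : Prop := spt mu \subset cost_max mu.

Definition basic mu : Prop :=
  forall nu, nu <> mu -> spt mu <> spt nu \/ cost_max mu <> cost_max nu.

Definition balanced_pairs (p : {set G} * {set G}) : Prop :=
  exists2 rho, balanced rho & p = (spt rho, cost_max rho).

End Transport.

Definition pair_le (V : finType) (p q : {set V} * {set V}) : bool :=
  (q.1 \subset p.1) && (p.2 \subset q.2).

Lemma pair_le_refl (V : finType) : reflexive (@pair_le V).
Proof. by move=> p; rewrite /pair_le !subxx. Qed.

Lemma pair_le_anti (V : finType) : antisymmetric (@pair_le V).
Proof.
move=> [S M] [S' M']; rewrite /pair_le /= => /andP[/andP[s1 m1] /andP[s2 m2]].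
by congr pair; apply/eqP; rewrite eqEsubset ?s1 ?s2 ?m1 ?m2.
Qed.

Lemma pair_le_trans (V : finType) : transitive (@pair_le V).
Proof.
move=> q p r /andP[s1 m1] /andP[s2 m2].
by rewrite /pair_le (subset_trans s2 s1) (subset_trans m1 m2).
Qed.

Definition is_maximal (X : Type) (le : rel X) (A : X -> Prop) (x : X) : Prop :=
  A x /\ forall y, A y -> le x y -> y = x.

(* Main.v *)
Require Import Defs.
From mathcomp Require Import all_boot all_order all_algebra.
From mathcomp Require Import reals.
From mathcomp Require Import ring lra.

(** Fix a vertex [m] of maximal cost.  Attach to a measure finitely many affine
    functionals of it, its slacks: the masses [mu v] and the deficits
    [cost mu m - cost mu v].  The measures whose cost is maximal at [m] form the
    polytope on which all the slacks are nonnegative.  The support and the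
    cost-maximizing set say exactly which slacks vanish, and the order on pairs
    is inclusion of these zero sets ([pair_le_slack]).  So a pair names the
    relative interior of a face; being basic says that the face is a single
    point, being maximal says that it has no proper subface.

    If [nu] is basic and the pair of [rho] is above that of [nu], the midpoint
    of [nu] and [rho] has the zero slacks of [nu] ([slack_midpoint]), hence is
    [nu] itself, hence [rho = nu].

    Conversely, if [mu] differs from [nu] but has the same pair, the ray from
    [mu] through [nu] leaves the polytope, because some mass decreases along
    it.  At the exit point all the slacks that vanished still vanish and a new
    one does, so the exit point is a balanced measure with a strictly larger
    pair ([exit_point]). *)

Set Implicit Arguments.
Unset Strict Implicit.
Unset Printing Implicit Defensive.

Import Order.TTheory GRing.Theory Num.Theory.

Local Open Scope ring_scope.

Lemma pmass_ge0 (R : realType) (V : finType) (mu : pmeasure R V) v : 0 <= mu v.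
Proof. by case: mu => mu /= /andP[/forallP]. Qed.

Lemma pmass_sum (R : realType) (V : finType) (mu : pmeasure R V) :
  \sum_v mu v = 1.
Proof. by case: mu => mu /= /andP[_ /eqP]. Qed.

Lemma pmeasure_ext (R : realType) (V : finType) (mu nu : pmeasure R V) :
  mu =1 nu -> mu = nu.
Proof. by move=> eq_mass; apply/val_inj/ffunP. Qed.

Lemma affine_pmeasure (R : realType) (V : finType) (mu nu : pmeasure R V)
    (a b : R) :
    a + b = 1 -> (forall v, 0 <= a * mu v + b * nu v) ->
  exists rho : pmeasure R V, forall v, rho v = a * mu v + b * nu v.
Proof.
move=> ab1 comb_ge0; pose f := [ffun v => a * mu v + b * nu v].
have f_prob : [forall v, 0 <= f v] && (\sum_v f v == 1).
  apply/andP; split; first by apply/forallP => v; rewrite ffunE.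
  under eq_bigr do rewrite ffunE.
  by rewrite big_split -!mulr_sumr /= !pmass_sum !mulr1 ab1.
by exists (PMeasure f_prob) => v /=; rewrite ffunE.
Qed.

(** As the masses of both measures add up to one, a measure dominated by another
    one is equal to it. *)
Lemma exists_pmass_lt (R : realType) (V : finType) (mu nu : pmeasure R V) :
  mu <> nu -> exists v, nu v < mu v.
Proof.
move=> neq; apply/existsP; apply: contraT; rewrite negb_exists => /forallP no_lt.
have ge_mu v : 0 <= nu v - mu v by rewrite subr_ge0 leNgt no_lt.
case: neq; apply: pmeasure_ext => v; apply/esym/eqP; rewrite -subr_eq0.
have : \sum_u (nu u - mu u) == 0 by rewrite sumrB !pmass_sum subrr.
by rewrite psumr_eq0 // => /allP/(_ v); rewrite mem_index_enum; apply.
Qed.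

Lemma spt_neq0 (R : realType) (G : connected_graph) (mu : pmeasure R G) :
  exists m, m \in spt mu.
Proof.
apply/set0Pn; apply/eqP => spt0; have := oner_neq0 R.
rewrite -(pmass_sum mu) big1 ?eqxx // => v _; apply/eqP.
by rewrite eq_le pmass_ge0 leNgt andbT; have := in_set0 v; rewrite -spt0 inE => ->.
Qed.

Lemma cost_maxP (R : realType) (G : connected_graph) (mu : pmeasure R G) v :
  reflect (forall u, cost mu u <= cost mu v) (v \in cost_max mu).
Proof.
rewrite inE; apply: (iffP eqP) => [-> u | max_v]; first exact: le_bigmax.
by apply/eqP; rewrite eq_le bigmax_ge_id; apply/bigmax_leP; split=> // u _.
Qed.

(** The masses and the cost deficits are put into one family because the proof
    treats both kinds of constraint alike. *)
Definition slack (R : realType) (G : connected_graph) (m : G)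
    (mu : pmeasure R G) (i : G + G) : R :=
  match i with
  | inl v => mu v
  | inr v => cost mu m - cost mu v
  end.

Section Slack.
Variables (R : realType) (G : connected_graph) (m : G).
Implicit Types mu nu rho : pmeasure R G.

Lemma slack_affine mu nu rho (a b : R) :
    (forall v, rho v = a * mu v + b * nu v) ->
  forall i, slack m rho i = a * slack m mu i + b * slack m nu i.
Proof.
move=> rhoE [] v //=.
have costE u : cost rho u = a * cost mu u + b * cost nu u.
  rewrite /cost !mulr_sumr -big_split /=; apply: eq_bigr => w _.
  by rewrite rhoE /=; ring.
by rewrite !costE; ring.
Qed.

Lemma slack_ge0 mu : m \in cost_max mu -> forall i, 0 <= slack m mu i.
Proof.
by move=> /cost_maxP max_m [] v /=; rewrite ?subr_ge0 ?max_m ?pmass_ge0.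
Qed.

Lemma cost_max_slack mu : (forall i, 0 <= slack m mu i) -> m \in cost_max mu.
Proof.
by move=> s_ge0; apply/cost_maxP => u; rewrite -subr_ge0; apply: (s_ge0 (inr u)).
Qed.

Lemma spt_slack mu v : (v \in spt mu) = (slack m mu (inl v) != 0).
Proof. by rewrite inE lt0r pmass_ge0 andbT. Qed.

Lemma mem_cost_max_slack mu v :
  m \in cost_max mu -> (v \in cost_max mu) = (slack m mu (inr v) == 0).
Proof.
move=> /cost_maxP max_m; rewrite /= subr_eq0.
apply/cost_maxP/eqP => [max_v | <- //].
by apply: le_anti; rewrite max_m max_v.
Qed.

(** The two inclusions of the order point in opposite directions since the
    support collects the nonzero masses and the cost-maximizing set the zero
    deficits. *)
Lemma pair_le_slack mu rho : m \in cost_max mu -> m \in cost_max rho ->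
  reflect (forall i, slack m mu i = 0 -> slack m rho i = 0)
          (pair_le (spt mu, cost_max mu) (spt rho, cost_max rho)).
Proof.
move=> max_mu max_rho; apply: (iffP andP) => [[/= sub_spt sub_max] | zeros].
  case=> v /eqP z; apply/eqP.
    by apply: contraTT z; rewrite -!spt_slack; apply: (subsetP sub_spt).
  rewrite -(mem_cost_max_slack v max_rho); apply: (subsetP sub_max).
  by rewrite (mem_cost_max_slack v max_mu).
split; apply/subsetP => v /=.
  by rewrite !spt_slack; apply: contra_neq => /zeros.
rewrite (mem_cost_max_slack v max_mu) (mem_cost_max_slack v max_rho).
by move=> /eqP/zeros/eqP.
Qed.

(** Nonnegative numbers have a zero average only if both are zero. *)
Lemma slack_midpoint nu rho :
    m \in cost_max nu -> m \in cost_max rho ->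
    pair_le (spt nu, cost_max nu) (spt rho, cost_max rho) ->
  exists2 mu : pmeasure R G, forall v, mu v = 2^-1 * nu v + 2^-1 * rho v
            & (spt mu, cost_max mu) = (spt nu, cost_max nu).
Proof.
move=> max_nu max_rho le_rho.
have [||mu muE] := @affine_pmeasure _ _ nu rho 2^-1 2^-1.
- by lra.
- by move=> v; have := pmass_ge0 nu v; have := pmass_ge0 rho v; lra.
exists mu => //; have sE := slack_affine muE.
have nu_ge0 := slack_ge0 max_nu; have rho_ge0 := slack_ge0 max_rho.
have max_mu : m \in cost_max mu.
  by apply: cost_max_slack => i; rewrite sE; have := nu_ge0 i; have := rho_ge0 i; lra.
apply: pair_le_anti; apply/andP; split; apply/pair_le_slack => // i.
  by rewrite sE; have := nu_ge0 i; have := rho_ge0 i; lra.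
by move=> z; rewrite sE z (pair_le_slack max_nu max_rho le_rho i z) !mulr0 addr0.
Qed.

(** The exit point is [(nu - c mu) / (1 - c)], where [c] is the least of the
    ratios [slack nu / slack mu] over the nonzero slacks of [mu]: this is the
    largest [c] that keeps all the slacks nonnegative, and the slack attaining
    the minimum becomes zero. *)
Lemma exit_point mu nu :
    m \in cost_max nu -> mu <> nu ->
    (spt mu, cost_max mu) = (spt nu, cost_max nu) ->
  exists rho,
    [/\ m \in cost_max rho,
        pair_le (spt nu, cost_max nu) (spt rho, cost_max rho)
      & exists2 i, slack m rho i = 0 & slack m nu i != 0].
Proof.
move=> max_nu neq eq_pair.
have max_mu : m \in cost_max mu by case: eq_pair => _ ->.
have nu_ge0 := slack_ge0 max_nu; have mu_ge0 := slack_ge0 max_mu.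
have mu_zeros i : slack m nu i = 0 -> slack m mu i = 0.
  by move: i; apply/pair_le_slack => //; rewrite eq_pair pair_le_refl.
have nu_zeros i : slack m mu i = 0 -> slack m nu i = 0.
  by move: i; apply/pair_le_slack => //; rewrite eq_pair pair_le_refl.
(* A mass that decreases from [mu] to [nu] bounds the least ratio below 1. *)
have [v0 lt_v0] := exists_pmass_lt neq.
have v0_pos : slack m mu (inl v0) != 0.
  by rewrite gt_eqF // (le_lt_trans (pmass_ge0 nu v0)).
pose ratio i := slack m nu i / slack m mu i.
case: (@Order.TotalTheory.arg_minP _ _ _ (inl v0) (fun i => slack m mu i != 0)
  ratio v0_pos) => i0 i0_pos i0_min.
set c := ratio i0 in i0_min.
have c_lt1 : c < 1.
  apply: le_lt_trans (i0_min _ v0_pos) _.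
  by rewrite /ratio ltr_pdivrMr ?mul1r // lt0r v0_pos mu_ge0.
have c_le i : c * slack m mu i <= slack m nu i.
  have [z | nz] := eqVneq (slack m mu i) 0; first by rewrite z mulr0.
  by rewrite -ler_pdivlMr ?i0_min // lt0r nz mu_ge0.
have inv_pos : 0 < (1 - c)^-1 by rewrite invr_gt0 subr_gt0.
have comb_ge0 i :
    0 <= (1 - c)^-1 * slack m nu i + - (c / (1 - c)) * slack m mu i.
  have -> : (1 - c)^-1 * slack m nu i + - (c / (1 - c)) * slack m mu i
    = (1 - c)^-1 * (slack m nu i - c * slack m mu i) by ring.
  by rewrite pmulr_rge0 // subr_ge0.
have [||rho rhoE] := @affine_pmeasure _ _ nu mu (1 - c)^-1 (- (c / (1 - c))).
- by field; rewrite subr_eq0 gt_eqF.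
- by move=> v; have := comb_ge0 (inl v).
have sE := slack_affine rhoE.
have max_rho : m \in cost_max rho by apply: cost_max_slack => i; rewrite sE.
exists rho; split=> //.
  by apply/pair_le_slack => // i z; rewrite sE (mu_zeros _ z) z !mulr0 addr0.
exists i0; last by apply: contra_neq i0_pos => /mu_zeros.
have s0E : slack m nu i0 = c * slack m mu i0 by rewrite /c /ratio divfK.
by rewrite sE s0E; ring.
Qed.

End Slack.

Theorem lemma2p9 (R : realType) (G : connected_graph) (nu : pmeasure R G)
    (hnu : balanced nu) :
  basic nu <->
  is_maximal (@pair_le G) (@balanced_pairs R G) (spt nu, cost_max nu).
Proof.
have [m m_spt] := spt_neq0 nu.
have max_nu : m \in cost_max nu := subsetP hnu m m_spt.
split=> [nu_basic | [_ nu_max] mu neq].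
  split=> [|p [rho _ ->] le_rho]; first by exists nu.
  have max_rho : m \in cost_max rho.
    by case/andP: (le_rho) => _ /subsetP; apply.
  have [mu muE [eq_spt eq_max]] := slack_midpoint max_nu max_rho le_rho.
  have [eq_mu | /eqP neq] := eqVneq mu nu; last first.
    by case: (nu_basic mu neq); rewrite ?eq_spt ?eq_max.
  suff -> : rho = nu by [].
  by apply: pmeasure_ext => v; have := muE v; rewrite eq_mu; lra.
have [eq_spt | /eqP] := eqVneq (spt nu) (spt mu); last by left.
have [eq_max | /eqP] := eqVneq (cost_max nu) (cost_max mu); last by right.
have eq_pair : (spt mu, cost_max mu) = (spt nu, cost_max nu).
  by rewrite eq_spt eq_max.
have [rho [max_rho le_rho [i rho0]]] := exit_point max_nu neq eq_pair.
have rho_bal : balanced rho.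
  case/andP: (le_rho) => /= sub_spt sub_max.
  exact: subset_trans sub_spt (subset_trans hnu sub_max).
have eq_rho : (spt rho, cost_max rho) = (spt nu, cost_max nu).
  by apply: nu_max le_rho; exists rho.
have/pair_le_slack-> // : pair_le (spt rho, cost_max rho) (spt nu, cost_max nu).
  by rewrite eq_rho pair_le_refl.
by rewrite eqxx.
Qed.
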